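(* Let $\Gamma$ be a group with finite symmetric generating set $S$ acting on a countably infinite set $X$ and preserving the mean $\mu$, and let $\bar\mu$ be the associated $\Gamma$-invariant regular Borel probability measure on $\beta X$. Then the action on $X$ is geometrically hyperfinite with respect to $\mu$ if and only if the extended action on $\beta X$ is hyperfinite with respect to $\bar\mu$.
   Context: A mean on $X$ is a finitely additive $\mu:2^X\to[0,1]$ with $\mu(X)=1$; $\bar\mu$ is the unique regular Borel probability on $\beta X$ (ultrafilters on $X$) with $\bar\mu(U_A)=\mu(A)$, $U_A=\{\omega:A\in\omega\}$. Bijections $s$ extend by $\tilde s(\omega)=\{s(A):A\in\omega\}$. The Schreier graph $S_\Gamma$ has vertex set $X$ and an edge $\{x,y\}$ when $x\ne y$ and $s(x)=y$ for some $s\in S$. For a subgraph $T$ of $S_\Gamma$, $\mu_E(T)=\frac12\sum_{k}k\,\mu(\{x:\deg_T(x)=k\})$. The action is geometrically hyperfinite w.r.t. $\mu$ if for every $\varepsilon>0$ there exist $K$ and a spanning subgraph $G_\varepsilon\subseteq S_\Gamma$ with $\mu_E(S_\Gamma\setminus G_\varepsilon)<\varepsilon$ (edges not in $G_\varepsilon$) all of whose components have at most $K$ vertices. The graphing $\mathcal G$ is the graph on $\beta X$ with an edge $\{\omega,\omega'\}$ when $\omega\ne\omega'$ and $\tilde s(\omega)=\omega'$ for some $s\in S$; for Borel $W\subseteq E(\mathcal G)$, $\bar\mu_E(W)=\frac12\int\deg_W\,d\bar\mu$. The extended action is hyperfinite w.r.t. $\bar\mu$ if for every $\varepsilon>0$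 there are $K$ and Borel $W\subseteq E(\mathcal G)$ with $\bar\mu_E(E(\mathcal G)\setminus W)<\varepsilon$ and all components of $(\beta X,W)$ of size at most $K$. *)

(* Defs.v *)
From HB Require Import structures.
From mathcomp Require Import all_boot all_order all_algebra.
From mathcomp Require Import all_classical all_reals all_analysis.
From mathcomp Require Import finmap.
From Stdlib Require Import Relations.
Set Implicit Arguments. Unset Strict Implicit. Unset Printing Implicit Defensive.
Import Order.TTheory GRing.Theory Num.Theory.
Local Open Scope classical_set_scope.
Local Open Scope ring_scope.
Local Open Scope card_scope.

Definition is_group (G : Type) (mul : G -> G -> G) (one : G) (inv : G -> G) :=
  [/\ forall a b c, mul a (mul b c) = mul (mul a b) c,
      forall a, mul one a = a, forall a, mul a one = a,
      forall a, mul (inv a) a = one & forall a, mul a (inv a) = one].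

Definition is_action (G X : Type) (mul : G -> G -> G) (one : G)
  (act : G -> X -> X) :=
  (forall x, act one x = x) /\ (forall g h x, act (mul g h) x = act g (act h x)).

Definition symmetric_gen (G : Type) (mul : G -> G -> G) (one : G) (inv : G -> G)
  (I : finType) (s : I -> G) :=
  (forall i, exists j, s j = inv (s i)) /\
  (forall g, exists w : seq I, g = foldr (fun i h => mul (s i) h) one w).

Definition is_mean (R : realType) (X : Type) (mu : set X -> R) :=
  [/\ forall A, 0 <= mu A <= 1, mu setT = 1 &
      forall A B, A `&` B = set0 -> mu (A `|` B) = mu A + mu B].

(* Graph notions (a graph is a symmetric relation on its vertex set)   *)
Definition deg (V : choiceType) (T : V -> V -> Prop) (v : V) : nat :=
  #|` fset_set [set w | T v w]|%fset.

Definition comp (V : Type) (T : V -> V -> Prop) (v : V) : set V :=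
  [set w | clos_refl_trans V T v w].

Definition edge_sub (V : Type) (T T' : V -> V -> Prop) := forall v w, T v w -> T' v w.
Definition edge_sym (V : Type) (T : V -> V -> Prop) := forall v w, T v w -> T w v.
Definition edge_diff (V : Type) (T' T : V -> V -> Prop) : V -> V -> Prop :=
  fun v w => T' v w /\ ~ T v w.

Definition schreier (G X : Type) (act : G -> X -> X) (I : finType) (s : I -> G)
  : X -> X -> Prop := fun x y => x <> y /\ exists i, act (s i) x = y.

(* mu_E(T) = 1/2 sum_k k mu{x : deg_T x = k}; in subgraphs of the Schreier graph
   degrees are at most #|I|, so the terms with k > #|I| vanish (mu set0 = 0). *)
Definition muE (R : realType) (X : pointedType) (mu : set X -> R) (n : nat)
  (T : X -> X -> Prop) : R :=
  2^-1 * \sum_(k < n.+1) (k%:R * mu [set x | deg T x = k]).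

Definition geom_hyperfinite (R : realType) (G : Type) (X : pointedType)
  (act : G -> X -> X) (I : finType) (s : I -> G) (mu : set X -> R) :=
  forall eps : R, 0 < eps -> exists K : nat, exists T : X -> X -> Prop,
    [/\ edge_sub T (schreier act s), edge_sym T,
        muE mu #|I| (edge_diff (schreier act s) T) < eps &
        forall x, comp T x #<= `I_K].

Record betaX (X : Type) := BetaPt {
  ufilt : set_system X ;
  ufiltP : UltraFilter ufilt }.

HB.instance Definition _ (X : Type) := gen_eqMixin (betaX X).
HB.instance Definition _ (X : Type) := gen_choiceMixin (betaX X).
HB.instance Definition _ (X : pointedType) :=
  isPointed.Build (betaX X) (BetaPt (principal_filter_ultra (@point X))).

Definition Ubase (X : Type) (A : set X) : set (betaX X) := [set w | ufilt w A].

Definition beta_open (X : Type) (O : set (betaX X)) :=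
  forall w, O w -> exists A, ufilt w A /\ Ubase A `<=` O.

Definition beta_compact (X : Type) (K : set (betaX X)) :=
  forall F : set (set (betaX X)), F `<=` @beta_open X ->
    K `<=` \bigcup_(O in F) O ->
    exists2 F' : set (set (betaX X)), finite_set F' & F' `<=` F /\ K `<=` \bigcup_(O in F') O.

Definition betaB (X : pointedType) := g_sigma_algebraType (@beta_open X).

Definition beta_regular (R : realType) (X : pointedType) (mb : set (betaB X) -> \bar R) :=
  forall B : set (betaB X), measurable B ->
    mb B = ereal_inf [set mb O | O in [set O | beta_open O /\ B `<=` O]] /\
    mb B = ereal_sup [set mb K | K in [set K | beta_compact K /\ K `<=` B]].

Definition btilde (G : Type) (X : Type) (act : G -> X -> X) (g : G)
  (w w' : betaX X) := ufilt w' = [set act g @` A | A in ufilt w].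

Definition gedge (G X : Type) (act : G -> X -> X) (I : finType) (s : I -> G)
  : betaX X -> betaX X -> Prop :=
  fun w w' => w <> w' /\ exists i, btilde act (s i) w w'.

(* W (a subset of the edge set of the graphing) is Borel: for each generator
   the set {w | {w, s~ w} in W} is Borel in beta X; as each s~ is a
   homeomorphism with closed graph, this is the same as W being Borel in
   beta X x beta X. *)
Definition borel_edges (G : Type) (X : pointedType) (act : G -> X -> X)
  (I : finType) (s : I -> G) (W : betaX X -> betaX X -> Prop) :=
  forall i, measurable
    ([set w | exists w', btilde act (s i) w w' /\ W w w'] : set (betaB X)).

Definition muEbar (R : realType) (X : pointedType)
  (mb : {measure set (betaB X) -> \bar R}) (W : betaX X -> betaX X -> Prop)
  : \bar R :=
  ((2^-1)%:E * \int[mb]_w ((deg W w)%:R)%:E)%E.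

Definition ext_hyperfinite (R : realType) (G : Type) (X : pointedType)
  (act : G -> X -> X) (I : finType) (s : I -> G)
  (mb : {measure set (betaB X) -> \bar R}) :=
  forall eps : R, 0 < eps -> exists K : nat, exists W : betaX X -> betaX X -> Prop,
    [/\ edge_sub W (gedge act s), edge_sym W, borel_edges act s W,
        (muEbar mb (edge_diff (gedge act s) W) < eps%:E)%E &
        forall w, comp W w #<= `I_K].

(* Main.v *)
(* For a bijection f of X, the pushed forward ultrafilter f w equals w only if f
   is the identity on a set of w; hence coincidences of words of the extended
   action at w, and membership in clopen sets along the orbit of w, are
   reproduced at some actual point x of X (bact_generic).  A spanning subgraph T
   of the Schreier graph therefore extends to a clopen subgraphing of the same
   edge measure, and K + 1 points in a component of the latter give K + 1 points
   in a component of T.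
   Conversely, regularity lets one replace the Borel sets of edges of W, one for
   each generator, by clopen sets; outside a set D of small measure (a union of
   boundedly many translates of the error sets) the new graph agrees with W on a
   ball of radius K + 1.  A component with more than K points shows K + 1 of them
   in the ball of radius K around each of its vertices, so deleting the vertices
   of such components costs at most the measure of D. *)
Require Import Defs.
From HB Require Import structures.
From mathcomp Require Import all_boot all_order all_algebra.
From mathcomp Require Import all_classical all_reals all_analysis.
From mathcomp Require Import finmap measurable_realfun lra.
From Stdlib Require Import Relations.
Set Implicit Arguments. Unset Strict Implicit. Unset Printing Implicit Defensive.
Import Order.TTheory GRing.Theory Num.Theory.
Local Open Scope classical_set_scope.
Local Open Scope ring_scope.
Local Open Scope card_scope.

(** * Ultrafilters on [X] and the maps they carry *)

Section Ultrafilters.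
Variable X : Type.
Implicit Types (w : betaX X) (A B : set X).

#[local] Instance ufilt_proper w : ProperFilter (ufilt w).
Proof. exact: (@ultra_proper _ _ (ufiltP w)). Qed.

Lemma ufilt0 w : ~ ufilt w set0.
Proof. exact: filter_not_empty. Qed.

Lemma ufiltI w A B : ufilt w A -> ufilt w B -> ufilt w (A `&` B).
Proof. exact: filterI. Qed.

Lemma ufiltS w A B : A `<=` B -> ufilt w A -> ufilt w B.
Proof. by move=> AB; exact: filterS. Qed.

Lemma ufiltC w A : ufilt w (~` A) <-> ~ ufilt w A.
Proof.
split => [wC wA|].
  by have := ufiltI wA wC; rewrite setICr => /ufilt0.
by case: (in_ultra_setVsetC A (ufiltP w)).
Qed.

Lemma ufiltU w A B : ufilt w (A `|` B) <-> ufilt w A \/ ufilt w B.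
Proof.
split => [|[]]; last 2 first.
- by apply: ufiltS => x; left.
- by apply: ufiltS => x; right.
move=> wAB; have [wA|/ufiltC wC] := pselect (ufilt w A); first by left.
by right; apply: (ufiltS _ (ufiltI wAB wC)) => x [[]].
Qed.

(** For each [j] either [A j] or its complement lies in [w]; the finite intersection of these
    choices lies in [w] too, hence has a point. *)
Lemma ufilt_generic w (J : finType) (A : J -> set X) :
  exists x, forall j, A j x <-> ufilt w (A j).
Proof.
suff H j : ufilt w [set x | A j x <-> ufilt w (A j)].
  exact: filter_ex (filter_forall _ H).
have [wA|/[dup] nwA /ufiltC wC] := pselect (ufilt w (A j)).
  by apply: (ufiltS _ wA) => x /= Ax; split.
by apply: (ufiltS _ wC) => x /= nAx; split.
Qed.

Lemma betaX_eq w w' : (forall A, ufilt w A <-> ufilt w' A) -> w = w'.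
Proof.
case: w w' => [F FU] [F' FU'] /= FF'.
have E : F = F' by apply/seteqP; split=> A /FF'.
by subst F'; congr BetaPt; exact: Prop_irrelevance.
Qed.

Lemma bmap_subproof (f : X -> X) w :
  UltraFilter [set A | ufilt w (f @^-1` A)].
Proof.
split; first exact: (@fmap_proper_filter _ _ f (ufilt w)).
move=> F FP sF; apply/seteqP; split=> [A FA|A]; last exact: sF.
case: (in_ultra_setVsetC (f @^-1` A) (ufiltP w)) => // wC.
have /sF FC : [set B | ufilt w (f @^-1` B)] (~` A) by [].
by case: (@filter_not_empty _ F FP); rewrite -(setICr A); exact: filterI.
Qed.

(** Stated with preimages, so that it makes sense for every map [f]; for the bijections [act g] it
    agrees with the image form [btilde] (see [btildeE]). *)
Definition bmap (f : X -> X) w : betaX X := BetaPt (bmap_subproof f w).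

Lemma bmap_comp (f g : X -> X) w : bmap (f \o g) w = bmap f (bmap g w).
Proof. exact: betaX_eq. Qed.

Lemma bmap_id w : bmap id w = w.
Proof. exact: betaX_eq. Qed.

(* Katetov's argument: for a maximal A disjoint from f @^-1` A, the sets A,
   f @^-1` A and g @^-1` A cover the points moved by f, and a fixed
   ultrafilter cannot contain any of them. *)
Lemma bmap_fixed (f g : X -> X) w : cancel f g ->
  bmap f w = w -> ufilt w [set x | f x = x].
Proof.
move=> fK fw; 
have wf B : ufilt w (f @^-1` B) <-> ufilt w B by rewrite -{2}fw.
pose P : set (set X) := [set A | A `&` f @^-1` A = set0].
have [A [PA maxA]] : exists A, P A /\ forall B, A `<` B -> ~ P B.
  apply: Zorn_bigcup => F FP Ftot.
  apply/seteqP; split => // x [[B FB Bx] [C FC Cx]].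
  have [BC|CB] := Ftot _ _ FB FC.
    by have := FP _ FC; rewrite /P /= => /seteqP[/(_ x) + _]; apply; split=> //; exact: BC.
  by have := FP _ FB; rewrite /P /= => /seteqP[/(_ x) + _]; apply; split=> //; exact: CB.
have disj x : A x -> A (f x) -> False.
  by move=> Ax Afx; have /seteqP[/(_ x) + _] := PA; apply; split.
have cov x : f x <> x -> [\/ A x, A (f x) | A (g x)].
  move=> fx; have [Ax|nAx] := pselect (A x); first by constructor 1.
  have [Afx|nAfx] := pselect (A (f x)); first by constructor 2.
  have [Agx|nAgx] := pselect (A (g x)); first by constructor 3.
  exfalso; apply: (maxA (x |` A)).
    by split; [move=> y Ay; right | by move=> /(_ x (or_introl erefl))/nAx].
  apply/seteqP; split => // y /= [[->|Ay] [fyx|Afy]].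
  - exact: fx.
  - exact: nAfx.
  - by apply: nAgx; rewrite -fyx fK.
  - exact: disj Ay Afy.
apply: contrapT => /ufiltC wN.
have : ufilt w (A `|` f @^-1` A `|` g @^-1` A).
  by apply: (ufiltS _ wN) => x /cov[]; [left; left|left; right|right].
have wg : ufilt w (g @^-1` A) <-> ufilt w A.
  rewrite -wf; suff -> : f @^-1` (g @^-1` A) = A by [].
  by apply/seteqP; split=> x /=; rewrite fK.
rewrite 2!ufiltU wf wg => wA.
have {}wA : ufilt w A by case: wA => [[]|].
by have := ufiltI wA ((wf A).2 wA); rewrite PA => /ufilt0.
Qed.

End Ultrafilters.

(** * Degrees as sums over generators *)

(** Several labels may lead to the same neighbour; each neighbour is counted once, at the least
    label reaching it. *)
Lemma deg_sum (I : finType) (V : choiceType) (f : I -> V)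
    (E : V -> V -> Prop) v :
  (forall v', E v v' -> exists i, v' = f i) ->
  deg E v = (\sum_(i : I) `[< E v (f i) /\
     forall j, (enum_rank j < enum_rank i)%N -> f j <> f i >])%N.
Proof.
move=> Ef.
pose P i := E v (f i) /\
  forall j, (enum_rank j < enum_rank i)%N -> f j <> f i.
rewrite -[RHS]/(\sum_(i : I) `[< P i >])%N.
have -> : (\sum_i `[< P i >])%N = size (enum [pred i | `[< P i >]]).
  rewrite -cardE -sum1_card [RHS]big_mkcond /=.
  by apply: eq_bigr => i _; rewrite inE; case: asboolP.
have finj : {in [pred i | `[< P i >]] &, injective f}.
  move=> i j; rewrite !inE => /asboolP[_ Pi] /asboolP[_ Pj] fij.
  case: (ltngtP (enum_rank i) (enum_rank j)) => [/Pj|/Pi|/val_inj/enum_rank_inj//].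
  - by rewrite fij.
  - by rewrite fij.
rewrite /deg; have -> : [set w | E v w] =
    [set` [fset f i | i in [pred i | `[< P i >]]]%fset].
  apply/seteqP; split => y /=.
    move=> /[dup] Evy /Ef[i0 yi0].
    apply/imfsetP => /=.
    have i0P : (fun i => f i == f i0) i0 by [].
    pose i := [arg min_(i < i0 | f i == f i0) (enum_rank i : nat)].
    have [k /eqP fk kmin] := @arg_minnP _ i0 (fun i => f i == f i0)
      (fun i => enum_rank i : nat) i0P.
    exists k; last by rewrite fk.
    rewrite ?inE; apply/asboolP; split; first by rewrite fk -yi0.
    move=> j jk fj; have := kmin j; rewrite fj fk eqxx => /(_ isT).
    by rewrite leqNgt jk.
  by move=> /imfsetP[i /=]; rewrite ?inE => /asboolP[Ei _] ->.
by rewrite set_fsetK card_in_imfset.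
Qed.

(** * Words in the generators and large components *)

Section Words.
Variables (G : Type) (mul : G -> G -> G) (one : G) (I : finType) (s : I -> G).

Definition gword (u : seq I) : G := foldr (fun i h => mul (s i) h) one u.

(** The last letter acts first. [C i] is the set of points where the edge labelled [i] may be used,
    so the word traces a path of allowed edges from [v]. *)
Fixpoint wpath (V : Type) (a : G -> V -> V) (C : I -> set V) (v : V)
    (u : seq I) : Prop :=
  if u is i :: u' then wpath a C v u' /\ C i (a (gword u') v) else True.

Lemma wpath_comp (V : Type) (a : G -> V -> V) (C : I -> set V)
    (E : V -> V -> Prop) v u :
  is_action mul one a -> (forall v' i, C i v' -> E v' (a (s i) v')) ->
  wpath a C v u -> Defs.comp E v (a (gword u) v).
Proof.
move=> [a1 aM] CE; elim: u => [_|i u IH] /=.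
  by rewrite a1; exact: rt_refl.
move=> [/IH vu Ci]; apply: rt_trans vu _; rewrite aM.
exact/rt_step/CE.
Qed.

Lemma comp_closed (V : Type) (E : V -> V -> Prop) (Q : set V) v v' :
  Q v -> (forall x y, Q x -> E x y -> Q y) -> Defs.comp E v v' -> Q v'.
Proof.
move=> Qv QE vv'; elim: vv' Qv => // [x y /[swap] |x y z _ IH1 _ IH2 /IH1/IH2//].
exact: QE.
Qed.

(** Distinct points of the component are collected one at a time, each new one by prepending a
    letter to a word already found; [K] extensions of the empty word give [K.+1] words of length at
    most [K]. *)
Lemma comp_large_words (V : choiceType) (a : G -> V -> V) (C : I -> set V)
    (E : V -> V -> Prop) v K :
  is_action mul one a ->
  (forall v v', E v v' -> exists2 i, v' = a (s i) v & C i v) ->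
  ~ (Defs.comp E v #<= `I_K) ->
  exists L : seq (seq I), [/\ size L = K.+1,
    forall u, u \in L -> (size u <= K)%N /\ wpath a C v u &
    uniq [seq a (gword u) v | u <- L]].
Proof.
move=> [a1 aM] EC big.
suff H n : (n <= K)%N -> exists L : seq (seq I), [/\ size L = n.+1,
    v \in [seq a (gword u) v | u <- L],
    forall u, u \in L -> (size u <= n)%N /\ wpath a C v u &
    uniq [seq a (gword u) v | u <- L]].
  by have [L [? _ ? ?]] := H K (leqnn K); exists L.
elim: n => [_|n IH nK].
  exists [:: [::]]; split => //=; first by rewrite a1 mem_head.
  by move=> u; rewrite inE => /eqP ->.
have [L [sL vL LP Lu]] := IH (ltnW nK).
set Q := [seq a (gword u) v | u <- L] in vL Lu.
(* If no edge left [Q], the component of [v] would lie in [Q], which has at most [K] points. *)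
have [x [y [xQ Exy yQ]]] : exists x y, [/\ x \in Q, E x y & y \notin Q].
  apply: contrapT => nQ; apply: big.
  apply: (@card_le_trans _ _ _ [set` Q]).
    apply: subset_card_le => y; apply: comp_closed => // x z xQ Exz.
    by apply/negP => zQ; apply: nQ; exists x, z; split => //; apply/negP.
  have -> : [set` Q] = [set` [fset q in Q]%fset].
    by apply/seteqP; split=> q /=; rewrite inE.
  apply: (@card_le_trans _ _ _ `I_(#|` [fset q in Q]%fset|)).
    have : [set` [fset q in Q]%fset] #= `I_(#|` [fset q in Q]%fset|) by exact/card_eq_fsetP.
    by rewrite card_eq_le => /andP[].
  by rewrite card_le_II card_fseq undup_id// size_map sL.
have /mapP[u uL xu] := xQ.
have [i yi Ci] := EC _ _ Exy.
exists ((i :: u) :: L); split => /=.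
- by rewrite sL.
- by rewrite inE vL orbT.
- move=> t; rewrite inE => /orP[/eqP ->|/LP[tn ?]]; last by split => //; exact: leqW.
  by have [un pu] := LP _ uL; split => //=; rewrite -xu.
- by rewrite Lu andbT aM -xu -yi.
Qed.

Lemma uniq_not_card_le (V : choiceType) (Q : seq V) (A : set V) K :
  uniq Q -> (forall y, y \in Q -> A y) -> (K < size Q)%N -> ~ (A #<= `I_K).
Proof.
move=> Qu QA KQ AK; have fA : finite_set A by exact: card_le_finite AK _.
have := geq_card_fset_set AK; rewrite leqNgt => /negP; apply.
apply: (leq_trans KQ); apply: uniq_leq_size => // y /QA Ay.
by rewrite in_fset_set//; exact: mem_set.
Qed.

End Words.

(** * The extended action and its local patterns *)

Section BetaAction.
Variables (G X : Type) (mul : G -> G -> G) (one : G) (inv : G -> G).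
Hypothesis hG : is_group mul one inv.
Variable act : G -> X -> X.
Hypothesis hact : is_action mul one act.

Definition bact (g : G) : betaX X -> betaX X := bmap (act g).

Lemma actK g : cancel (act g) (act (inv g)).
Proof. by case: hG hact => _ _ _ gV _ [a1 aM] x; rewrite -aM gV a1. Qed.

Lemma actVK g : cancel (act (inv g)) (act g).
Proof. by case: hG hact => _ _ _ _ gV [a1 aM] x; rewrite -aM gV a1. Qed.

Lemma bact_action : is_action mul one bact.
Proof.
case: hact => [a1 aM]; split => [w|g h w].
  rewrite -[RHS]bmap_id /bact; congr bmap; exact/funext.
rewrite /bact -bmap_comp; congr bmap; exact/funext/aM.
Qed.

Lemma btildeE g w w' : btilde act g w w' <-> w' = bact g w.
Proof.
have E A : [set act g @` A | A in ufilt w] A <-> ufilt w (act g @^-1` A).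
  split=> [[B wB <-]|wA].
    by apply: (ufiltS _ wB) => x Bx; exists x.
  exists (act g @^-1` A) => //; apply/seteqP; split => [_ [x Ax <-] //|x Ax].
  by exists (act (inv g) x) => /=; rewrite actVK.
rewrite /btilde; split=> [ww'|->].
  by apply: betaX_eq => A; rewrite ww'; exact: E.
by apply/seteqP; split => A; rewrite E.
Qed.

(** A coincidence of [g] and [h] at [w] says that [w] is fixed by the bijection of [X] given by
    $h^{-1}g$, so [bmap_fixed] applies. *)
Lemma bact_eq g h w :
  bact g w = bact h w <-> ufilt w [set x | act g x = act h x].
Proof.
have [_ aM] := hact; have [b1 bM] := bact_action.
case: (hG) => _ _ _ hV _.
split=> [gh|wE].
  have : bact (mul (inv h) g) w = w by rewrite bM gh -bM hV b1.
  have fK : cancel (act (mul (inv h) g)) (act (mul (inv g) h)).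
    by move=> x; rewrite !aM actVK actK.
  move=> /(bmap_fixed fK); apply: ufiltS => x /=.
  by rewrite aM => /(congr1 (act h)); rewrite actVK.
apply: betaX_eq => A /=; split=> wA.
  by apply: (ufiltS _ (ufiltI wE wA)) => x [/= <-].
by apply: (ufiltS _ (ufiltI wE wA)) => x [/= ->].
Qed.

Variables (I : finType) (s : I -> G).
Local Notation gw := (gword mul one s).

(* A point x on which the finitely many coincidences and memberships visible in
   the ball of radius K around w are reproduced. *)
Lemma bact_generic (J : finType) (A : J -> set X) (C : I -> set X) w (K : nat) :
  exists x, [/\ forall j, A j x <-> ufilt w (A j),
    forall u v, (size u <= K)%N -> (size v <= K)%N ->
      act (gw u) x = act (gw v) x <-> bact (gw u) w = bact (gw v) w &
    forall u i, (size u <= K)%N ->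
      C i (act (gw u) x) <-> ufilt (bact (gw u) w) (C i)].
Proof.
pose B (j : J + (K.-bseq I * K.-bseq I) + (K.-bseq I * I)) : set X :=
  match j with
  | inl (inl j) => A j
  | inl (inr (u, v)) => [set x | act (gw u) x = act (gw v) x]
  | inr (u, i) => act (gw u) @^-1` C i
  end.
have [x Bx] := ufilt_generic w B; exists x; split=> [j|u v uK vK|u i uK].
- exact: (Bx (inl (inl j))).
- by rewrite bact_eq; exact: (Bx (inl (inr (Bseq uK, Bseq vK)))).
- exact: (Bx (inr (Bseq uK, i))).
Qed.

End BetaAction.

(** * Clopen approximation and edge measures on [betaX X] *)

Section BetaMeasure.
Variable (X : pointedType).

Lemma Ubase_open (A : set X) : beta_open (Ubase A).
Proof. by move=> w wA; exists A; split. Qed.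

Lemma beta_open_measurable (O : set (betaX X)) : beta_open O ->
  measurable (O : set (betaB X)).
Proof. by move=> oO; exact: sub_sigma_algebra. Qed.

Lemma Ubase_measurable (A : set X) : measurable (Ubase A : set (betaB X)).
Proof. by apply: beta_open_measurable; exact: Ubase_open. Qed.

(** Compactness turns a local property into a global one: finitely many sets satisfying [P] suffice
    to cover, and their union still satisfies [P]. *)
Lemma beta_compact_Ubase (K : set (betaX X)) (P : set (set X)) :
  beta_compact K -> P set0 -> (forall A B, P A -> P B -> P (A `|` B)) ->
  (forall w, K w -> exists2 A, P A & ufilt w A) ->
  exists2 C, P C & K `<=` Ubase C.
Proof.
move=> Kc P0 PU KP.
have [||F' finF' [F'P KF']] := Kc [set Ubase A | A in P].
- by move=> _ [A _ <-]; exact: Ubase_open.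
- by move=> w /KP[A PA wA]; exists (Ubase A) => //; exists A.
suff [C PC F'C] : exists2 C, P C & \bigcup_(O in F') O `<=` Ubase C.
  by exists C => //; exact: subset_trans F'C.
have /finite_seqP[L F'L] := finF'; rewrite {}F'L in F'P *.
elim: L F'P {finF' KF'} => [_|O L IH OP]; first by exists set0 => // w [].
have [|C PC LC] := IH; first by move=> B BL; apply: OP => /=; rewrite inE BL orbT.
have [|A PA AO] := OP O; first by rewrite /= mem_head.
exists (A `|` C); first exact: PU.
move=> w [B /=]; rewrite inE => /orP[/eqP ->|BL] Bw; apply/ufiltU.
  by left; rewrite -AO in Bw.
by right; apply: LC; exists B.
Qed.

(** Compact sets are closed because ultrafilters are separated by sets: for [w] outside [K], every
    point of [K] contains a set not in [w], and one such set serves for all of [K]. *)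
Lemma beta_compact_measurable (K : set (betaX X)) : beta_compact K ->
  measurable (K : set (betaB X)).
Proof.
move=> Kc; rewrite -[K]setCK; apply: measurableC; apply: beta_open_measurable.
move=> w nKw.
have [|||C nwC KC] := @beta_compact_Ubase K [set A | ~ ufilt w A] Kc.
- exact: ufilt0.
- by move=> A B nA nB /ufiltU[].
- move=> w' Kw'; apply: contrapT => H; apply: nKw.
  suff <- : w' = w by [].
  apply: betaX_eq => A; split=> [w'A|wA].
    by apply: contrapT => nwA; apply: H; exists A.
  apply: contrapT => /ufiltC w'A; apply: H; exists (~` A) => // /ufiltC; exact.
exists (~` C); split; first exact/ufiltC.
by move=> w' /ufiltC nC Kw'; apply: nC; exact: KC.
Qed.

Lemma bmap_open (f : X -> X) (O : set (betaX X)) :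
  beta_open O -> beta_open (bmap f @^-1` O).
Proof.
move=> oO w /= /oO[A [wA AO]]; exists (f @^-1` A); split => // w' w'A.
exact: AO.
Qed.

Lemma bmap_measurable (f : X -> X) (B : set (betaB X)) : measurable B ->
  measurable (bmap f @^-1` B : set (betaB X)).
Proof.
move=> mB; have : measurable_fun setT (bmap f : betaB X -> betaB X).
  apply: (@measurability _ _ (betaB X) (betaB X) setT (bmap f) (@beta_open X)) => // _ [U oU <-].
  by rewrite setTI; apply: beta_open_measurable; exact: bmap_open.
by move=> /(_ measurableT _ mB); rewrite setTI.
Qed.

Variables (R : realType) (mb : probability (betaB X) R).
Hypothesis hreg : beta_regular mb.


Lemma compact_between (K O : set (betaX X)) : beta_compact K -> beta_open O ->
  K `<=` O -> exists2 C, K `<=` Ubase C & Ubase C `<=` O.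
Proof.
move=> Kc oO KO.
have [|||C CO KC] := @beta_compact_Ubase K [set A | Ubase A `<=` O] Kc.
- by move=> w /ufilt0.
- by move=> A B AO BO w /ufiltU[/AO|/BO].
- by move=> w /KO/oO[A [wA AO]]; exists A.
by exists C.
Qed.

(** Regularity encloses [B] between a compact [K] and an open [O] that differ by less than [d]. A
    clopen set between them differs from [B] only inside [O] minus [K]. *)
Lemma beta_approx (B : set (betaB X)) (d : R) : measurable B -> 0 < d ->
  exists C, (mb ((B `\` Ubase C) `|` (Ubase C `\` B)) < d%:E)%E.
Proof.
move=> mB d0; have d20 : 0 < d / 2 by rewrite divr_gt0.
have [Binf Bsup] := hreg mB.
have fB : mb B \is a fin_num by exact: fin_num_measure.
have [_ [ O [oO BO] <-] Od] : exists2 x,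
    [set mb O | O in [set O | beta_open O /\ B `<=` O]] x & (x < mb B + (d / 2)%:E)%E.
  by rewrite Binf; apply: lb_ereal_inf_adherent => //; rewrite -Binf.
have [_ [K [Kc KB] <-] Kd] : exists2 x,
    [set mb K | K in [set K | beta_compact K /\ K `<=` B]] x & (mb B - (d / 2)%:E < x)%E.
  by rewrite Bsup; apply: ub_ereal_sup_adherent => //; rewrite -Bsup.
have [C KC CO] := compact_between Kc oO (subset_trans KB BO).
have mO : measurable (O : set (betaB X)) := beta_open_measurable oO.
have mK : measurable (K : set (betaB X)) := beta_compact_measurable Kc.
have mC : measurable (Ubase C : set (betaB X)) := Ubase_measurable C.
exists C; apply: (@le_lt_trans _ _ (mb (O `\` K : set (betaB X)))).
  apply: le_measure.
  - by apply: mem_set; apply: measurableU; exact: measurableD.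
  - by apply: mem_set; exact: measurableD.
  - move=> w [[Bw nCw]|[Cw nBw]]; split.
    + exact: BO.
    + by move=> /KC.
    + exact: CO.
    + by move=> /KB.
have fK : mb K \is a fin_num by exact: fin_num_measure.
have fO : mb O \is a fin_num by exact: fin_num_measure.
rewrite measureD//; last by rewrite ltey_eq fO.
rewrite (_ : O `&` K = K); last by apply: setIidr; exact: subset_trans BO.
have {}Od : fine (mb O) < fine (mb B) + d / 2 by rewrite -lte_fin EFinD !fineK.
have {}Kd : fine (mb B) - d / 2 < fine (mb K) by rewrite -lte_fin EFinB !fineK.
suff : fine (mb O) - fine (mb K) < d by rewrite -lte_fin EFinB !fineK.
move: Od Kd; clear; lra.
Qed.

Lemma asbool_indic (Y : Type) (A : set Y) x : (`[< A x >])%:R = \1_A x :> R.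
Proof. by rewrite indicE; case: asboolP => h; [rewrite (mem_set h)|rewrite (memNset h)]. Qed.

Lemma integral_sum_indic (I : finType) (A : I -> set (betaB X)) :
  (forall i, measurable (A i)) ->
  (\int[mb]_w ((\sum_(i : I) `[< A i w >])%N%:R)%:E = \sum_(i : I) mb (A i))%E.
Proof.
move=> mA.
under eq_integral => w _.
  rewrite natr_sum -sumEFin.
  under eq_bigr => i _ do rewrite asbool_indic.
  over.
rewrite ge0_integral_sum//.
- by apply: eq_bigr => i _; rewrite integral_indic// setIT.
by move=> i; exact/measurable_EFinP/measurable_indic.
Qed.

Variable mu : set X -> R.
Hypothesis hmb : forall A : set X, mb (Ubase A) = (mu A)%:E.

(** The left side sorts vertices by degree, the right side by label. Both become integrals over
    [betaX X], whose integrands are compared pointwise. *)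
Lemma muE_sum (I : finType) (D : X -> X -> Prop) (A : I -> set X) :
  (forall x, deg D x = \sum_(i : I) `[< A i x >])%N ->
  ((muE mu #|I| D)%:E = (2^-1)%:E * \sum_(i : I) mb (Ubase (A i)))%E.
Proof.
move=> degE; rewrite /muE EFinM; congr (_ * _)%E.
pose Q (k : 'I_#|I|.+1) := [set x | deg D x = k].
rewrite -integral_sum_indic; last by move=> i; exact: Ubase_measurable.
transitivity (\sum_(k < #|I|.+1) \int[mb]_w ((k%:R)%:E * (\1_(Ubase (Q k)) w)%:E))%E.
  rewrite -sumEFin; apply: eq_bigr => k _.
  rewrite ge0_integralZl_EFin//.
  - rewrite integral_indic// ?setIT; last exact: Ubase_measurable.
    by rewrite EFinM -hmb.
  - by apply/measurable_EFinP/measurable_indic; exact: Ubase_measurable.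
rewrite -ge0_integral_sum//; last first.
  move=> k; apply: emeasurable_funM => //.
  by apply/measurable_EFinP/measurable_indic; exact: Ubase_measurable.
apply: eq_integral => w _.
pose B (j : 'I_#|I|.+1 + I) := match j with inl k => Q k | inr i => A i end.
(* At a point [x] imitating [w], both integrands take the value [deg D x]: exactly one level set
   [Q k] contains [x]. *)
have [x Bx] := ufilt_generic w B.
transitivity ((deg D x)%:R%:E : \bar R).
  under eq_bigr => k _ do rewrite -asbool_indic -EFinM.
  rewrite sumEFin; congr EFin.
  have degx : (deg D x < #|I|.+1)%N.
    rewrite ltnS degE -sum1_card; apply: leq_sum => i _; exact: leq_b1.
  rewrite (bigD1 (Ordinal degx))//= big1 ?addr0 => [|k kx].
    rewrite asboolT ?mulr1//; exact/(Bx (inl (Ordinal degx))).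
  rewrite asboolF ?mulr0// => /(Bx (inl k)).2 /= xk.
  by move: kx; rewrite -val_eqE /= xk eqxx.
rewrite degE; congr (_%:R%:E); apply: eq_bigr => i _; congr nat_of_bool.
by apply: asbool_equiv_eq; exact: (Bx (inr i)).
Qed.

End BetaMeasure.

(** * Transfer of paths and distinct points between [X] and [betaX X] *)

Section Transfer.
Variables (G : Type) (mul : G -> G -> G) (one : G) (I : finType) (s : I -> G).
Local Notation gw := (gword mul one s).

Lemma wpath_impl (V V' : Type) (a : G -> V -> V) (a' : G -> V' -> V')
    (C : I -> set V) (C' : I -> set V') v v' K u :
  (forall u i, (size u <= K)%N -> C i (a (gw u) v) -> C' i (a' (gw u) v')) ->
  (size u <= K)%N -> wpath mul one s a C v u -> wpath mul one s a' C' v' u.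
Proof.
move=> CC'; elim: u => //= i u IH uK [vu Cu]; split; first exact/IH/vu/ltnW.
exact/CC'/Cu/ltnW.
Qed.

Lemma uniq_map_impl (T : eqType) (V V' : eqType) (f : T -> V) (f' : T -> V')
    (L : seq T) :
  (forall u v, u \in L -> v \in L -> f' u = f' v -> f u = f v) ->
  uniq [seq f u | u <- L] -> uniq [seq f' u | u <- L].
Proof.
elim: L => //= t L IH ff' /andP[tL uL]; apply/andP; split.
  apply: contra tL => /mapP[v vL tv]; apply/mapP; exists v => //.
  by apply: ff' => //; rewrite ?mem_head// inE vL orbT.
by apply: IH uL => u v uL vL; apply: ff'; rewrite inE ?uL ?vL orbT.
Qed.

(** The tie-breaking condition of [deg_sum]. *)
Definition first_label (V : Type) (a : G -> V -> V) (i : I) (v : V) : Prop :=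
  forall j, (enum_rank j < enum_rank i)%N -> a (s j) v <> a (s i) v.

End Transfer.

(** Here [a] is the number of generators, [b] the number of error sets and [d] the bound on each;
    the extra [d] in [a * b + 1] makes the inequality strict. *)
Lemma budget_lt (R : realFieldType) (eps r d a b : R) :
  0 < d -> 0 <= a -> 0 <= b -> d * (a * b + 1) = eps - 2^-1 * r ->
  2^-1 * (r + a * (b * d)) < eps.
Proof.
move=> d0 a0 b0 dE; have := mulr_ge0 (mulr_ge0 a0 b0) (ltW d0); lra.
Qed.

(** * Invariance of the measure under the extended action *)

Section Main.
Variables (R : realType) (G : Type) (mul : G -> G -> G) (one : G) (inv : G -> G).
Hypothesis hG : is_group mul one inv.
Variables (I : finType) (s : I -> G).
Hypothesis s_inv : forall i, exists j, s j = inv (s i).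
Variables (X : pointedType) (act : G -> X -> X).
Hypothesis hact : is_action mul one act.
Variable mu : set X -> R.
Hypothesis hpres : forall g A, mu (act g @` A) = mu A.
Variable mb : probability (betaB X) R.
Hypothesis hreg : beta_regular mb.
Hypothesis hmb : forall A : set X, mb (Ubase A) = (mu A)%:E.

Local Notation gw := (gword mul one s).
Local Notation bact := (bact act).

Lemma mb_le (A B : set (betaB X)) : measurable A -> measurable B ->
  A `<=` B -> (mb A <= mb B)%E.
Proof. by move=> mA mB; apply: le_measure; exact: mem_set. Qed.

(** By inner regularity it is enough to bound compact subsets of the preimage. Each lies in a clopen
    subset, whose translate has the same measure by invariance of [mu] and lies in [O]. *)
Lemma mb_bact_open g (O : set (betaX X)) : beta_open O ->
  (mb (bact g @^-1` O : set (betaB X)) <= mb O)%E.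
Proof.
move=> oO; have oP : beta_open (bact g @^-1` O) by exact: bmap_open.
have [_ ->] := hreg (beta_open_measurable oP).
apply: ge_ereal_sup => _ [K [Kc KO] <-].
have [C KC CO] := compact_between Kc oP KO.
apply: (@le_trans _ _ (mb (Ubase C))).
  by apply: mb_le => //; [exact: beta_compact_measurable|exact: Ubase_measurable].
rewrite hmb -(hpres g) -hmb; apply: mb_le.
- exact: Ubase_measurable.
- exact: beta_open_measurable.
move=> w wC; have -> : w = bact g (bact (inv g) w).
  have [_ bM] := bact_action hact; have [b1 _] := bact_action hact.
  by case: hG => _ _ _ _ gV; rewrite -bM gV b1.
apply: CO; apply: (ufiltS _ wC) => _ [x Cx <-] /=.
by rewrite (actK hG hact).
Qed.

Lemma mb_bact g (B : set (betaB X)) : measurable B ->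
  (mb (bact g @^-1` B : set (betaB X)) <= mb B)%E.
Proof.
move=> mB; rewrite [leRHS](hreg mB).1.
apply: le_ereal_inf_tmp => _ [U [oU BU] <-].
apply: le_trans (mb_bact_open g oU); apply: mb_le.
- exact: bmap_measurable.
- by apply: bmap_measurable; exact: beta_open_measurable.
- by move=> w; exact: BU.
Qed.

Lemma mb_finite_union (J : finType) (F : J -> set (betaB X)) (d : R) :
  (forall j, measurable (F j)) -> (forall j, (mb (F j) <= d%:E)%E) ->
  measurable ([set w | exists j, F j w] : set (betaB X)) /\
  (mb [set w | exists j, F j w] <= (#|J|%:R * d)%:E)%E.
Proof.
move=> mF Fd.
have -> : [set w | exists j, F j w] = [set w | exists2 j, j \in enum J & F j w].
  apply/seteqP; split=> w [j]; last by exists j.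
  by exists j => //; rewrite mem_enum.
rewrite cardE; elim: (enum J) => [|j L [mL Ld]].
  rewrite (_ : [set w | _] = set0) ?measure0 ?mul0r//.
  by apply/seteqP; split=> // w [].
have -> : [set w | exists2 k, k \in j :: L & F k w] =
    F j `|` [set w | exists2 k, k \in L & F k w].
  apply/seteqP; split=> w /=.
    by move=> [k]; rewrite inE => /orP[/eqP -> |kL Fk]; [left|right; exists k].
  by move=> [Fj|[k kL Fk]]; [exists j|exists k] => //; rewrite inE ?eqxx ?kL ?orbT.
split; first exact: measurableU.
apply: le_trans (measureU2 _ (mF j) mL) _ => /=.
by rewrite -natr1 mulrDl mul1r addrC EFinD; exact: leeD.
Qed.

Lemma gedge_bact w i : gedge act s w (bact (s i) w) <-> w <> bact (s i) w.
Proof.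
by split=> [[]//|h]; split=> //; exists i; apply/(btildeE hG hact).
Qed.

Lemma schreier_act x i : schreier act s x (act (s i) x) <-> x <> act (s i) x.
Proof. by split=> [[]//|h]; split=> //; exists i. Qed.

Lemma bact_inv i j w : s j = inv (s i) -> bact (s j) (bact (s i) w) = w.
Proof.
move=> ->; have [b1 bM] := bact_action hact.
by case: hG => _ _ _ Vg _; rewrite -bM Vg b1.
Qed.

(** Radius 1 suffices to compare incident edges, and hence degrees and first labels, at [w] and at
    [x]. *)
Lemma bact_generic1 (J : finType) (A : J -> set X) (C : I -> set X) w :
  exists x, [/\ forall j, A j x <-> ufilt w (A j),
    forall i, x = act (s i) x <-> w = bact (s i) w,
    forall i, first_label s act i x <-> first_label s bact i w,
    forall i, C i x <-> ufilt w (C i) &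
    forall i j, C j (act (s i) x) <-> ufilt (bact (s i) w) (C j)].
Proof.
have [x [Ax eqx Cx]] := bact_generic hG hact s A C w 1.
have gw1 i : gw [:: i] = s i by case: hG => _ _ m1 _ _; rewrite /= m1.
have [a1 _] := hact; have [b1 _] := bact_action hact.
have eqs i j : act (s i) x = act (s j) x <-> bact (s i) w = bact (s j) w.
  by have := eqx [:: i] [:: j] isT isT; rewrite !gw1.
exists x; split=> //.
- by move=> i; have := eqx [::] [:: i] isT isT; rewrite gw1 -[gw [::]]/one a1 b1.
- by move=> i; split=> h j /h; rewrite eqs.
- by move=> i; have := Cx [::] i isT; rewrite -[gw [::]]/one a1 b1.
- by move=> i j; have := Cx [:: i] j isT; rewrite gw1.
Qed.

(** * From [X] to [betaX X] *)

Lemma geom_to_ext : geom_hyperfinite act s mu -> ext_hyperfinite act s mb.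
Proof.
move=> geo eps /geo[K [T [TS Tsym Tmu Tcomp]]]; exists K.
have [a1 aM] := hact; have [b1 bM] := bact_action hact.
pose c i : set X := [set x | T x (act (s i) x)].
pose W w w' := exists2 i, w' = bact (s i) w & ufilt w (c i).
(* Membership in [W] does not depend on the label: labels that agree at [w] agree on a set of
   [w]. *)
have WE w i : W w (bact (s i) w) <-> ufilt w (c i).
  split=> [[j ij wj]|wi]; last by exists i.
  have /(bact_eq hG hact) wij := ij.
  by apply: (ufiltS _ (ufiltI wij wj)) => x [/= ]; rewrite /c /= => ->.
have Wg : edge_sub W (gedge act s).
  move=> w _ [i -> wi]; apply/gedge_bact => wE.
  have /(bact_eq hG hact) : bact one w = bact (s i) w by rewrite b1.
  move=> /(ufiltI wi) wii; apply: (@ufilt0 _ w); apply: (ufiltS _ wii) => x [/TS[+ _]].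
  by rewrite /= a1.
exists W; split=> //.
- move=> w _ [i -> wi]; have [j ji] := s_inv i.
  exists j; first by rewrite bact_inv.
  apply: (ufiltS _ wi) => x /= /Tsym; rewrite /c /= ji.
  by rewrite (actK hG hact).
- move=> i; rewrite (_ : [set w | _] = Ubase (c i)); first exact: Ubase_measurable.
  apply/seteqP; split=> w /=.
    by move=> [_ [/(btildeE hG hact) -> /WE]].
  by move=> wi; exists (bact (s i) w); split; [exact/(btildeE hG hact)|exact/WE].
(* The missing edges of [W] at first label [i] form exactly the clopen set of [A i], so both edge
   measures are the same sum. *)
- pose A i := [set x | edge_diff (schreier act s) T x (act (s i) x) /\
                       first_label s act i x].
  have degW w : deg (edge_diff (gedge act s) W) w =
      (\sum_(i : I) `[< Ubase (A i) w >])%N.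
    rewrite (@deg_sum I _ (fun i => bact (s i) w)); last first.
      by move=> v' [[_ [i /(btildeE hG hact) ->]] _]; exists i.
    apply: eq_bigr => i _; congr nat_of_bool; apply: asbool_equiv_eq.
    have [x [Ax eqx fx cx _]] := bact_generic1 (fun _ : unit => A i) c w.
    rewrite -[X in _ <-> X]/(ufilt w (A i)) -(Ax tt) /A /= /edge_diff.
    by rewrite gedge_bact schreier_act WE -cx -eqx -[X in _ /\ X]/(first_label s bact i w) -fx.
  rewrite /muEbar; under eq_integral => w _ do rewrite degW.
  rewrite integral_sum_indic; last by move=> i; exact: Ubase_measurable.
  rewrite -(muE_sum hmb (D := edge_diff (schreier act s) T)) ?lte_fin// => x.
  by rewrite (@deg_sum I _ (fun i => act (s i) x))// => v' [[_ [i <-]] _]; exists i.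
(* A component of [W] with more than [K] points is imitated around some [x], against the bound on
   [T]. *)
- move=> w; apply: contrapT => big.
  have [||L [sL LP Lu]] := @comp_large_words _ mul one I s _ bact
    (fun i => Ubase (c i)) W w K _ _ big.
  + exact: bact_action.
  + by move=> v v' [i -> ?]; exists i.
  have [x [_ eqx cx]] := bact_generic hG hact s (fun _ : unit => setT) c w K.
  apply: (@uniq_not_card_le _ [seq act (gw u) x | u <- L] _ K) (Tcomp x).
  + apply: uniq_map_impl Lu => u v /LP[uK _] /LP[vK _].
    by move=> /(eqx _ _ uK vK).
  + move=> _ /mapP[u /LP[uK up] ->].
    apply: (wpath_comp (C := c)) => //.
    by apply: (wpath_impl _ uK) up => t i tK /(cx _ _ tK).
  + by rewrite size_map sL.
Qed.

(** * From [betaX X] to [X] *)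

Lemma ext_to_geom : ext_hyperfinite act s mb -> geom_hyperfinite act s mu.
Proof.
(* The bound [K.+1] covers the singleton components of deleted vertices even if [K] is 0. *)
move=> ext eps /ext[K [W [WG Wsym Wbor Wmu Wcomp]]]; exists K.+1.
have [a1 aM] := hact; have [b1 bM] := bact_action hact.
pose B i : set (betaB X) := [set w | W w (bact (s i) w)].
have mB i : measurable (B i).
  rewrite (_ : B i = [set w | exists w', btilde act (s i) w w' /\ W w w']) //.
  apply/seteqP; split=> w /=; last by move=> [_ [/(btildeE hG hact) ->]].
  by move=> wi; exists (bact (s i) w); split=> //; exact/(btildeE hG hact).
pose M i : set (betaB X) := [set w |
  edge_diff (gedge act s) W w (bact (s i) w) /\ first_label s bact i w].
have mM i : measurable (M i).
  (* Having an edge with first label [i] is a clopen condition. *)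
  rewrite (_ : M i = Ubase [set x | x <> act (s i) x /\ first_label s act i x] `\` B i).
    by apply: measurableD => //; exact: Ubase_measurable.
  apply/seteqP; split=> w.
    have [x [Ax eqx fx _ _]] := bact_generic1
      (fun _ : unit => [set x | x <> act (s i) x /\ first_label s act i x])
      (fun=> setT) w.
    move=> [[/gedge_bact wi nW] wf]; split=> //; apply/(Ax tt); split.
      by rewrite eqx.
    exact/fx.
  have [x [Ax eqx fx _ _]] := bact_generic1
    (fun _ : unit => [set x | x <> act (s i) x /\ first_label s act i x])
    (fun=> setT) w.
  move=> [/(Ax tt)[wi wf] nW]; split; last exact/fx.
  by split=> //; apply/gedge_bact; rewrite -eqx.
have {}Wmu : ((2^-1)%:E * \sum_(i : I) mb (M i) < eps%:E)%E.
  move: Wmu; rewrite /muEbar -integral_sum_indic//.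
  congr (_ * _ < _)%E; apply: eq_integral => w _.
  rewrite (@deg_sum I _ (fun i => bact (s i) w))//.
  by move=> v' [[_ [i /(btildeE hG hact) ->]] _]; exists i.
(* Words of length [K] serve to bound components; [K.+1] also admits the one-letter words used for
   reversed edges when [K] is 0. *)
pose N := #|{: K.+1.-bseq I * I}|.
have fM i : mb (M i) \is a fin_num by exact: fin_num_measure.
pose r := \sum_(i : I) fine (mb (M i)).
have rE : (\sum_(i : I) mb (M i) = r%:E)%E.
  by rewrite /r -sumEFin; apply: eq_bigr => i _; rewrite fineK.
rewrite rE -EFinM lte_fin in Wmu.
(* The slack left by [W], shared among [N] error sets for each generator. *)
pose d := (eps - 2^-1 * r) / (#|I| * N).+1%:R.
have d0 : 0 < d by rewrite divr_gt0 ?subr_gt0 ?ltr0n.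
have /choice[c cB] i := beta_approx hreg (mB i) d0.
pose E i : set (betaB X) := (B i `\` Ubase (c i)) `|` (Ubase (c i) `\` B i).
have mE i : measurable (E i).
  by apply: measurableU; apply: measurableD => //; exact: Ubase_measurable.
pose F (p : K.+1.-bseq I * I) : set (betaB X) := bact (gw p.1) @^-1` E p.2.
have mF p : measurable (F p) by exact: bmap_measurable.
have Fd p : (mb (F p) <= d%:E)%E.
  by apply: le_trans (mb_bact _ (mE _)) (ltW (cB _)).
have [] := mb_finite_union mF Fd; rewrite -/N; set D := [set w | _] => mD Dd.
have nD w u i : ~ D w -> (size u <= K.+1)%N ->
    B i (bact (gw u) w) <-> ufilt (bact (gw u) w) (c i).
  move=> Dw uK; split=> h; apply: contrapT => nh; apply: Dw; exists (Bseq uK, i).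
    by left.
  by right.
(* The clopen approximations [c i] need not respect edge reversal, so an edge is kept only if it is
   accepted from both ends. *)
pose T0 x y := [/\ x <> y, exists2 i, y = act (s i) x & c i x
  & exists2 j, x = act (s j) y & c j y].
have T0sym x y : T0 x y -> T0 y x by move=> [xy ? ?]; split=> // /esym.
pose Z : set X := [set x | ~ (Defs.comp T0 x #<= `I_K)].
(* Otherwise a point of [Z] imitating [w] shows [K.+1] distinct points on short words; off [D] these
   paths run in [W], whose components are too small. *)
have DZ w : ~ D w -> ~ ufilt w Z.
  move=> Dw wZ.
  have [x [Zx eqx cx]] := bact_generic hG hact s (fun _ : unit => Z) c w K.
  have {}Zx := (Zx tt).2 wZ.
  have [||L [sL LP Lu]] := @comp_large_words _ mul one I s _ act c T0 x K _ _ Zx.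
  - by [].
  - by move=> v v' [_ [i]]; exists i.
  apply: (@uniq_not_card_le _ [seq bact (gw u) w | u <- L] _ K) (Wcomp w).
  - apply: uniq_map_impl Lu => u v /LP[uK _] /LP[vK _].
    by move=> /(eqx _ _ uK vK).
  - move=> _ /mapP[u /LP[uK up] ->].
    apply: (wpath_comp (C := B)); first exact: bact_action.
      by [].
    by apply: (wpath_impl _ uK) up => t i tK /(cx _ _ tK) ?; apply/nD => //; exact: leqW.
  - by rewrite size_map sL.
pose T x y := T0 x y /\ ~ Z x.
(* [Z] is a union of components of [T0], so removing the edges at [Z] keeps symmetry. *)
have T0Z x y : T0 x y -> Z y -> Z x.
  move=> xy Zy xK; apply: Zy; apply: card_le_trans xK; apply: subset_card_le => z.
  by apply: rt_trans; exact: rt_step.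
exists T; split.
- by move=> x y [[xy [i yi _] _] _]; split=> //; exists i.
- move=> x y [xy nZ]; split; first exact: T0sym.
  by move=> Zy; apply: nZ; exact: T0Z Zy.
- pose A i := [set x | edge_diff (schreier act s) T x (act (s i) x) /\
                       first_label s act i x].
  rewrite -lte_fin (muE_sum hmb (A := A)); last first.
    move=> x; rewrite (@deg_sum I _ (fun i => act (s i) x))//.
    by move=> v' [[_ [i <-]] _]; exists i.
  (* Off [D], an edge of [W] is accepted from both ends and avoids [Z], so it survives in [T]; every
     edge lost is one already missing from [W]. *)
  have AM i : Ubase (A i) `<=` M i `|` D.
    move=> w wA; have [Dw|Dw] := pselect (D w); first by right.
    left.
    have [x [AZ eqx fx cx cax]] := bact_generic1
      (fun b : bool => if b then A i else Z) c w.
    have [[/schreier_act xi nT] xf] := (AZ true).2 wA.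
    have nZ : ~ Z x by rewrite (AZ false); exact: DZ.
    split; last exact/fx.
    split; first by apply/gedge_bact; rewrite -eqx.
    move=> Wi; apply: nT; split=> //; split=> //.
      exists i => //; apply/cx.
      by have := nD w [::] i Dw isT; rewrite -[gw [::]]/one b1 => <-.
    have [j ji] := s_inv i.
    exists j; first by rewrite ji (actK hG hact).
    apply/cax; have := nD w [:: i] j Dw isT.
    have -> : gw [:: i] = s i by case: hG => _ _ m1 _ _; rewrite /= m1.
    move=> <-.
    by rewrite /B /= bact_inv//; exact: Wsym.
  have Ab i : (mb (Ubase (A i)) <= mb (M i) + (N%:R * d)%:E)%E.
    apply: le_trans (leeD (lexx _) Dd).
    apply: le_trans (measureU2 _ (mM i) mD).
    by apply: mb_le => //; [exact: Ubase_measurable|exact: measurableU].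
  apply: (@le_lt_trans _ _ ((2^-1)%:E * \sum_(i : I) (mb (M i) + (N%:R * d)%:E))%E).
    apply: lee_wpmul2l; first by rewrite lee_fin invr_ge0.
    by apply: lee_sum.
  rewrite big_split /= rE sumEFin -EFinD -EFinM lte_fin.
  have sumI (t : R) : \sum_(i : I) t = #|I|%:R * t.
    by rewrite mulr_natl -sumr_const; apply: eq_bigl => i; rewrite inE.
  rewrite sumI.
  have dE : d * (#|I| * N).+1%:R = eps - 2^-1 * r by rewrite /d divfK// pnatr_eq0.
  by apply: budget_lt d0 _ _ _; rewrite ?ler0n// -natrM natr1.
(* A vertex of [Z] is isolated in [T]; any other has a component inside its small [T0] component. *)
- move=> x; have [Zx|nZx] := pselect (Z x).
    apply: (@card_le_trans _ _ _ [set x]).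
      apply: subset_card_le => y; apply: comp_closed => // u v -> [_ /(_ Zx)//].
    have := @card_set1 _ x; rewrite card_eq_le => /andP[x1 _].
    by apply: card_le_trans x1 _; rewrite card_le_II.
  have xK : Defs.comp T0 x #<= `I_K by apply: contrapT.
  apply: (@card_le_trans _ _ _ `I_K); last by rewrite card_le_II.
  apply: card_le_trans xK; apply: subset_card_le => y.
  elim=> [u v [uv _]|u|u v t _ uv _ vt]; [exact: rt_step|exact: rt_refl|].
  exact: rt_trans uv vt.
Qed.

End Main.

Theorem theorem4p5 (R : realType)
  (G : Type) (mul : G -> G -> G) (one : G) (inv : G -> G)
  (hG : is_group mul one inv)
  (I : finType) (s : I -> G) (hS : symmetric_gen mul one inv s)
  (X : pointedType) (hX : [set: X] #= [set: nat])
  (act : G -> X -> X) (hact : is_action mul one act)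
  (mu : set X -> R) (hmu : is_mean mu)
  (hpres : forall g A, mu (act g @` A) = mu A)
  (mb : probability (betaB X) R) (hreg : beta_regular mb)
  (hmb : forall A : set X, mb (Ubase A) = (mu A)%:E) :
  geom_hyperfinite act s mu <-> ext_hyperfinite act s mb.
Proof.
have [s_inv _] := hS; split.
  exact: (@geom_to_ext _ _ mul one inv).
exact: (@ext_to_geom _ _ mul one inv).
Qed.
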